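(* Let $n\ge2$ and $k$ be integers with $0\le k\le n$, and let $\mathcal{C}\le\mathbb{F}_q^n$ be a $k$-dimensional $\mathbb{F}_q$-linear code. Then $$\rho^{\mathrm{H}}(\mathcal{C})=n-k,\quad\text{provided that the prime power } q \text{ is sufficiently large (with } n,k \text{ fixed)}.$$ Equivalently, if $\mathcal{F}$ is the family of $k$-dimensional $\mathbb{F}_q$-linear codes in $\mathbb{F}_q^n$ and $\mathcal{F}':=\{\mathcal{C}\in\mathcal{F}\mid\rho^{\mathrm{H}}(\mathcal{C})=n-k\}$, then $|\mathcal{F}'|/|\mathcal{F}|=1$ for $q$ sufficiently large.
   Context: $\rho^{\mathrm{H}}(\mathcal{C})$ is the covering radius of $\mathcal{C}$ with respect to the Hamming distance: the smallest $r\in\mathbb{N}$ such that every $x\in\mathbb{F}_q^n$ is at Hamming distance at most $r$ from some element of $\mathcal{C}$. *)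

(* Defs.v *)
From HB Require Import structures.
From mathcomp Require Import all_boot all_order all_algebra.

Set Implicit Arguments.
Unset Strict Implicit.
Unset Printing Implicit Defensive.

Import GRing.Theory VectorInternalTheory.
Local Open Scope ring_scope.

(* Over a finite field, the subspaces of a finite-dimensional space form a
   finite type, so that families of linear codes are finite sets and can be
   counted. *)
Section FiniteVspace.
Variables (F : finFieldType) (vT : vectType F).
HB.instance Definition _ := [Countable of {vspace vT} by <:].
HB.instance Definition _ := [Finite of {vspace vT} by <:].
End FiniteVspace.

Section CoveringRadius.
Variables (F : finFieldType) (n : nat).

Definition hamming_dist (x y : 'rV[F]_n) : nat :=
  #|[set i : 'I_n | x 0 i != y 0 i]|.

Definition covers (C : {vspace 'rV[F]_n}) (r : nat) : bool :=
  [forall x : 'rV[F]_n, [exists c in C, hamming_dist x c <= r]%N].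

Lemma covers_exists (C : {vspace 'rV[F]_n}) : exists r, covers C r.
Proof.
exists n; apply/forallP => x; apply/existsP; exists 0.
by rewrite mem0v -[X in (_ <= X)%N](card_ord n) max_card.
Qed.

Definition covering_radius (C : {vspace 'rV[F]_n}) : nat :=
  ex_minn (covers_exists C).

Definition codes (k : nat) : {set {vspace 'rV[F]_n}} :=
  [set C : {vspace 'rV[F]_n} | (\dim C == k)%N].

Definition max_radius_codes (k : nat) : {set {vspace 'rV[F]_n}} :=
  [set C in codes k | covering_radius C == (n - k)%N].

End CoveringRadius.

Arguments codes : clear implicits.
Arguments max_radius_codes : clear implicits.

(* Main.v *)
Require Import Defs.
From mathcomp Require Import all_boot all_order all_algebra.
From mathcomp Require Import finfield.

(** Write V_S for the span of the unit vectors indexed by S.  The ball of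
    radius r around C is the union of the subspaces C + V_S with #|S| <= r.
    For r >= n - k some C + V_S is the whole space, since C can be completed to
    the whole space by n - k unit vectors; for r < n - k each of these at most
    2^n subspaces has at most q^(n-1) elements, so they cannot cover the q^n
    vectors when q > 2^n. *)

Local Open Scope ring_scope.

Import GRing.Theory Num.Theory.

Lemma dimv_rowf (F : fieldType) (n : nat) : \dim {: 'rV[F]_n} = n.
Proof. by rewrite dimvf dim_matrix mul1r. Qed.

Definition coord_space (F : fieldType) (n : nat) (S : {set 'I_n}) :
    {vspace 'rV[F]_n} :=
  (\sum_(i in S) <[(delta_mx 0 i : 'rV[F]_n)%R]>)%VS.

Arguments coord_space : clear implicits.

(** Turns membership in V_S into a condition on the support, which is what the Hamming distance
    sees. *)
Lemma mem_coord_space (F : fieldType) (n : nat) (S : {set 'I_n}) (v : 'rV[F]_n) :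
  (v \in coord_space F n S) = [forall i, (i \notin S) ==> (v 0 i == 0)].
Proof.
apply/memv_sumP/forallP => [[vs vsP ->] j | v0].
  apply/implyP => jS; rewrite summxE big1 // => i iS.
  have /vlineP[a ->] := vsP _ iS.
  rewrite !mxE eqxx; case: eqP => [ji | _]; last by rewrite mulr0.
  by rewrite ji iS in jS.
exists (fun i => v 0 i *: delta_mx 0 i) => [i _|].
  by rewrite memvZ ?memv_line.
rewrite {1}[v]row_sum_delta (bigID (mem S)) /= [X in _ + X]big1 ?addr0 // => i iS.
by rewrite (eqP (implyP (v0 i) iS)) scale0r.
Qed.

Lemma dim_coord_space (F : fieldType) (n : nat) (S : {set 'I_n}) :
  (\dim (coord_space F n S) <= #|S|)%N.
Proof.
apply: leq_trans (dimv_leq_sum _ _ _) _.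
rewrite -sum1_card leq_sum // => i _.
by rewrite dim_vline; case: (_ != _).
Qed.

Lemma coord_spaceU1 (F : fieldType) (n : nat) (i : 'I_n) (S : {set 'I_n}) :
  (coord_space F n S + <[(delta_mx 0 i : 'rV[F]_n)%R]>
     <= coord_space F n (i |: S))%VS.
Proof.
rewrite subv_add; apply/andP; split.
  by apply/subv_sumP => j jS; rewrite (sumv_sup j) // !inE jS orbT.
by rewrite (sumv_sup i) // setU11.
Qed.

(** Greedy completion, as in Steinitz exchange: a proper subspace misses some unit vector, and
    adjoining it raises the dimension. Keeping [j] free lets the induction add one vector at a
    time. *)
Lemma coord_space_extend {F : fieldType} {n : nat} (U : {vspace 'rV[F]_n}) (j : nat) :
  (\dim U + j <= n)%N ->
  exists S : {set 'I_n},
    (#|S| <= j)%N /\ (\dim U + j <= \dim (U + coord_space F n S))%N.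
Proof.
elim: j => [|j IHj] le_n.
  by exists set0; rewrite cards0 addn0 dimvS // addvSl.
have [|S [Sj dimS]] := IHj; first by apply: leq_trans le_n; rewrite addnS.
set W := (U + coord_space F n S)%VS in dimS.
(* If [W] contains every unit vector, it is the whole space and [S] already works; otherwise an
   index [i] outside [W] is added to [S]. *)
have [/forallP allW | /forallPn[i iW]] :=
    boolP [forall i, (delta_mx 0 i : 'rV[F]_n) \in W].
  exists S; split; first exact: leqW.
  suff -> : (U + coord_space F n S = fullv)%VS by rewrite dimv_rowf.
  apply/vspaceP => v; rewrite memvf [v]row_sum_delta.
  by apply: memv_suml => i _; rewrite memvZ ?allW.
exists (i |: S); split.
  by rewrite cardsU1 -add1n leq_add // leq_b1.
apply: (@leq_trans (\dim (W + <[(delta_mx 0 i : 'rV[F]_n)%R]>)%VS)); last first.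
  by rewrite dimvS // -addvA addvS // coord_spaceU1.
rewrite addnS; apply: leq_ltn_trans dimS _.
rewrite (ltn_leqif (dimv_leqif_sup (addvSl W _))).
by rewrite subv_add subvv /= -memvE.
Qed.

Section Covering.
Variables (F : finFieldType) (n : nat).
Implicit Types (C : {vspace 'rV[F]_n}).

(** The error [x - c] lies in V_S exactly when [x] and [c] agree outside [S], so [S] can be taken as
    the set where they differ. *)
Lemma covered_by_coord_space C (x : 'rV[F]_n) (r : nat) :
  reflect (exists2 S : {set 'I_n}, (#|S| <= r)%N & x \in (C + coord_space F n S)%VS)
          [exists c in C, (hamming_dist x c <= r)%N].
Proof.
apply: (iffP existsP) => [[c /andP[cC xc]] | [S Sr /memv_addP[c cC [e eS ->]]]].
  exists [set i | x 0 i != c 0 i] => //.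
  rewrite -[X in X \in _](subrKC c) memv_add // mem_coord_space.
  apply/forallP => i; rewrite inE negbK; apply/implyP => /eqP xci.
  by rewrite !mxE xci subrr.
exists c; rewrite cC; apply: leq_trans Sr; apply/subset_leq_card/subsetP => i.
rewrite inE; apply: contraR => iS; move: eS; rewrite mem_coord_space.
by move/forallP/(_ i)/implyP/(_ iS)/eqP; rewrite !mxE => ->; rewrite addr0.
Qed.

Lemma covers_codim C : covers C (n - \dim C).
Proof.
have dimC : (\dim C <= n)%N.
  by rewrite -[X in (_ <= X)%N](dimv_rowf F) dimvS ?subvf.
have dimCE : (\dim C + (n - \dim C) = n)%N by rewrite subnKC.
have [|S [cardS dimS]] := coord_space_extend C (n - \dim C).
  by rewrite dimCE.
apply/forallP => x; apply/covered_by_coord_space; exists S => //.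
suff -> : (C + coord_space F n S = fullv)%VS by rewrite memvf.
apply/eqP; rewrite -(dimv_leqif_eq (subvf _)) eqn_leq dimvS ?subvf //=.
by rewrite dimv_rowf -[X in (X <= _)%N]dimCE.
Qed.

(** Union bound: the sets C + V_S with [#|S| <= r] cover the space, and each has dimension at most
    [\dim C + r]. *)
Lemma covers_card_bound C (r : nat) :
  covers C r -> (#|F| ^ n <= 2 ^ n * #|F| ^ (\dim C + r))%N.
Proof.
move=> /forallP Cr.
pose B (S : {set 'I_n}) := [set x in (C + coord_space F n S)%VS].
have cover_B : [set: 'rV[F]_n] \subset \bigcup_(S : {set 'I_n} | (#|S| <= r)%N) B S.
  apply/subsetP => x _; have /covered_by_coord_space[S Sr xS] := Cr x.
  by apply/bigcupP; exists S; rewrite ?inE.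
have card_B (S : {set 'I_n}) : (#|S| <= r)%N -> (#|B S| <= #|F| ^ (\dim C + r))%N.
  move=> Sr; rewrite cardsE card_vspace leq_pexp2l ?(ltnW (finRing_gt1 _)) //.
  apply: leq_trans (dimv_add_leqif _ _) _.
  by rewrite leq_add2l (leq_trans (dim_coord_space _ _ _)).
have := subset_leq_card cover_B.
rewrite cardsT card_mx mul1n => /leq_trans; apply.
apply: (@leq_trans (\sum_(S : {set 'I_n} | (#|S| <= r)%N) #|F| ^ (\dim C + r))%N).
  elim/big_rec2: _ => [|S m A Sr le_mA]; first by rewrite cards0.
  by apply: leq_trans (leq_card_setU _ _) _; rewrite leq_add ?card_B.
(* The number of sets of size at most [r] is bounded crudely by the number 2^n of all subsets. *)
rewrite sum_nat_const leq_mul2r; apply/orP; right.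
by rewrite (leq_trans (max_card _)) // -cardsT -powersetT card_powerset cardsT card_ord.
Qed.

Lemma covering_radius_codim C :
  (2 ^ n < #|F|)%N -> covering_radius C = (n - \dim C)%N.
Proof.
move=> q_gt; rewrite /covering_radius; case: ex_minnP => r Cr r_min.
apply/eqP; rewrite eqn_leq r_min ?covers_codim //= leqNgt; apply/negP => r_lt.
have := covers_card_bound _ _ Cr; rewrite leqNgt => /negP; apply.
have n_gt0 : (0 < n)%N by rewrite (leq_trans _ (leq_subr (\dim C) n)) // (leq_trans _ r_lt).
have q_gt0 : (0 < #|F|)%N by rewrite (leq_trans _ q_gt).
(* From r < n - dim C follows dim C + r <= n - 1, so the counting bound would give q^n <= 2^n
   q^(n-1), against q > 2^n. *)
apply: (@leq_ltn_trans (2 ^ n * #|F| ^ n.-1)).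
  rewrite leq_mul2l leq_pexp2l ?orbT // -ltnS prednK //.
  by rewrite -ltn_subRL.
have -> : (#|F| ^ n = #|F| * #|F| ^ n.-1)%N by rewrite -expnS prednK.
by rewrite ltn_pmul2r ?expn_gt0 ?q_gt0.
Qed.

(** Keeps the denominator of the proportion nonzero; the first [k] vectors of a basis of the whole
    space span such a code. *)
Lemma codes_neq0 (k : nat) : (k <= n)%N -> codes F n k != set0.
Proof.
move=> k_le_n; pose X := vbasis {: 'rV[F]_n}.
apply/set0Pn; exists <<take k X>>%VS; rewrite inE.
have /eqP -> : free (take k X).
  by apply: (@catl_free _ _ (drop k X)); rewrite cat_take_drop (basis_free (vbasisP _)).
by rewrite size_takel // size_tuple dimv_rowf.
Qed.

End Covering.

Theorem proposition8p3 (n k : nat) (n_ge2 : (2 <= n)%N) (k_le_n : (k <= n)%N) :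
  exists q0 : nat, forall F : finFieldType, (q0 <= #|F|)%N ->
    (forall C : {vspace 'rV[F]_n},
       (\dim C = k)%N -> covering_radius C = (n - k)%N) /\
    (#|max_radius_codes F n k|%:R / #|codes F n k|%:R = 1 :> rat).
Proof.
(* The successor encodes the strict bound 2^n < q; this threshold does not depend on [k]. *)
exists (2 ^ n).+1 => F q_gt; split=> [C <- | ]; first exact: covering_radius_codim.
have -> : max_radius_codes F n k = codes F n k.
  apply/setP => C; rewrite !inE; case: eqP => //= <-.
  by rewrite covering_radius_codim ?eqxx.
by rewrite divff // pnatr_eq0 cards_eq0 codes_neq0.
Qed.
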